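(* Let $G$ be a countable graph with maximal degree $\le\mathrm{D}$ and $H=\mathcal{A}+V$ on $\ell^2(G)$, with $\mathcal{A}$ the adjacency matrix and $V$ a bounded real potential. Fix $o\in G$, let $|x|=d(x,o)$ be the graph distance and $(x^m\psi)(x)=|x|^m\psi(x)$. Then for each $m\in\mathbb{N}$ there are polynomials $p_0,\dots,p_m$ (depending on $m$ but not on $\psi$ or $t$), with $p_k$ of degree $k$, $p_0\equiv1$, and the leading term of $p_m(t)$ equal to $\mathrm{D}^mt^m$, such that for every $t\ge0$ and every $\psi\in\ell^2(G)$ with $\|x^m\psi\|<\infty$, $$\|x^me^{-\mathrm{i}tH}\psi\|\le\sum_{r=0}^mp_{m-r}(t)\|x^r\psi\|.$$ In particular, $\limsup_{t\to+\infty}\|x^me^{-\mathrm{i}tH}\psi\|/t^m\le\mathrm{D}^m\|\psi\|$. *)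

(* Defs.v *)
From HB Require Import structures.
From mathcomp Require Import all_boot all_order all_algebra.
From mathcomp Require Import complex.
From mathcomp Require Import all_classical all_reals all_analysis.
Set Implicit Arguments. Unset Strict Implicit. Unset Printing Implicit Defensive.
Import Order.TTheory GRing.Theory Num.Theory.
Import numFieldNormedType.Exports.
Local Open Scope classical_set_scope.
Local Open Scope ring_scope.
Local Open Scope complex_scope.

Section Defs.
Variables (R : realType) (T : countType).

Definition walk_len (e : rel T) (o x : T) (n : nat) : Prop :=
  exists p : seq T, [/\ size p = n, path e o p & last o p = x].

Definition gdist (e : rel T) (o x : T) : nat :=
  xget 0%N [set n | walk_len e o x n /\ forall k, walk_len e o x k -> (n <= k)%N].

Definition cabs2 (z : R[i]) : R := (complex.Re z) ^+ 2 + (complex.Im z) ^+ 2.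

Definition wnorm2 (e : rel T) (o : T) (r : nat) (psi : T -> R[i]) : \bar R :=
  (\esum_(x in [set: T]) (((gdist e o x)%:R ^+ (2 * r) * cabs2 (psi x) : R)%:E))%E.

Definition wnorm (e : rel T) (o : T) (r : nat) (psi : T -> R[i]) : R :=
  Num.sqrt (fine (wnorm2 e o r psi)).

Definition Hop (e : rel T) (V : T -> R) (psi : T -> R[i]) : T -> R[i] :=
  fun x => (\sum_(y \in [set y | e x y]) psi y) + (V x)%:C * psi x.

(* e^{-itH} psi, coordinatewise sum of the norm-convergent exponential series *)
Definition evol (e : rel T) (V : T -> R) (t : R) (psi : T -> R[i]) : T -> R[i] :=
  fun x => limn (series (fun n : nat =>
     ((- 'i * t%:C) ^+ n / (n`!)%:R) * iter n (Hop e V) psi x)).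

End Defs.

(* Main.v *)
Require Import Defs.
From HB Require Import structures.
From mathcomp Require Import all_boot all_order all_algebra.
From mathcomp Require Import finmap ring lra.
From mathcomp Require Import complex.
From mathcomp Require Import all_classical all_reals all_analysis.
Set Implicit Arguments. Unset Strict Implicit. Unset Printing Implicit Defensive.
Import Order.TTheory GRing.Theory Num.Theory.
Import numFieldNormedType.Exports.
Local Open Scope classical_set_scope.
Local Open Scope ring_scope.

(** The evolution is the pointwise limit of the Euler scheme
    [(1 - i (t/n) H)^n psi].  Since [H] is symmetric,
    [|(1 - i h H) w|^2 = |w|^2 + h^2 |H w|^2], so one step costs a factor
    [1 + O(h^2)] on [w = x^r psi], plus the commutator [h [x^r, H] psi], whose
    norm is at most [h D \sum_(j < r) 'C(r, j) |x^j psi|] because only the edges of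
    the graph change the distance, and by at most one.  The recursion is solved by
    [p_k(t) = 'C(m, k) (D t + k)^k], and the accumulated factor
    [(1 + O(n^-2))^n] tends to 1.  Both the Euler scheme at a point and the norms are
    controlled on finite sets of vertices, so the estimate is one about finite
    antisymmetric matrices; the lower semicontinuity of the sum of squares
    passes it to the limit. *)

(** * Finite weighted Euler estimate *)

Section FiniteNorm.
Variables (R : rcfType) (J : finType).
Implicit Types (f g : J -> R) (K : J -> J -> R).

Definition fnorm f : R := Num.sqrt (\sum_j f j ^+ 2).

Lemma fnorm_ge0 f : 0 <= fnorm f.
Proof. exact: sqrtr_ge0. Qed.

Lemma fnorm_sqr f : fnorm f ^+ 2 = \sum_j f j ^+ 2.
Proof. by rewrite sqr_sqrtr ?sumr_ge0// => j _; rewrite sqr_ge0. Qed.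

Lemma eq_fnorm f g : f =1 g -> fnorm f = fnorm g.
Proof. by move=> fg; rewrite /fnorm; under eq_bigr do rewrite fg. Qed.

Lemma ler_fnorm f g : (forall j, `|f j| <= `|g j|) -> fnorm f <= fnorm g.
Proof.
move=> fg; apply: ler_wsqrtr; apply: ler_sum => j _.
by rewrite -(real_normK (num_real (f j))) -(real_normK (num_real (g j))) lerXn2r ?nnegrE.
Qed.

Lemma fnorm_le f c : 0 <= c -> \sum_j f j ^+ 2 <= c ^+ 2 -> fnorm f <= c.
Proof. by move=> c0 /ler_wsqrtr; rewrite sqrtr_sqr ger0_norm. Qed.

(** Cauchy-Schwarz through Lagrange's identity: twice the defect is the double sum of the squared
    minors [f i * g j - f j * g i]. *)
Lemma sum_mul_sqr_le f g :
  (\sum_j f j * g j) ^+ 2 <= (\sum_j f j ^+ 2) * (\sum_j g j ^+ 2).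
Proof.
have : 0 <= \sum_i \sum_j (f i * g j - f j * g i) ^+ 2.
  by do 2!(apply: sumr_ge0 => ? _); rewrite sqr_ge0.
have -> : \sum_i \sum_j (f i * g j - f j * g i) ^+ 2 =
   2 * ((\sum_j f j ^+ 2) * (\sum_j g j ^+ 2) - (\sum_j f j * g j) ^+ 2).
  rewrite [X in _ = 2 * (X - _)]mulr_suml expr2 [X in _ - X]mulr_suml -sumrB mulr_sumr.
  have E1 i : f i ^+ 2 * (\sum_j g j ^+ 2) = \sum_j f i ^+ 2 * g j ^+ 2 by rewrite mulr_sumr.
  have E2 i : f i * g i * (\sum_j f j * g j) = \sum_j f i * g i * (f j * g j) by rewrite mulr_sumr.
  under [RHS]eq_bigr do rewrite E1 E2 -sumrB mulr_sumr.
  have E3 : \sum_i \sum_j f i ^+ 2 * g j ^+ 2 = \sum_i \sum_j f j ^+ 2 * g i ^+ 2.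
    exact: exchange_big.
  apply/eqP; rewrite -subr_eq0 -sumrB.
  under eq_bigr do rewrite -sumrB.
  apply/eqP; transitivity (\sum_i \sum_j (f j ^+ 2 * g i ^+ 2 - f i ^+ 2 * g j ^+ 2)).
    by do 2!(apply: eq_bigr => ? _); ring.
  by under eq_bigr do rewrite sumrB; rewrite sumrB E3 subrr.
by rewrite pmulr_rge0 ?ltr0n// subr_ge0.
Qed.

Lemma fnormD f g : fnorm (fun j => f j + g j) <= fnorm f + fnorm g.
Proof.
apply: fnorm_le; first by rewrite addr_ge0 ?fnorm_ge0.
have fg : \sum_j f j * g j <= fnorm f * fnorm g.
  rewrite (le_trans (ler_norm _))// -(@ler_pXn2r _ 2)// ?nnegrE ?mulr_ge0 ?fnorm_ge0//.
  by rewrite real_normK ?num_real// exprMn !fnorm_sqr sum_mul_sqr_le.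
rewrite [leRHS]sqrrD !fnorm_sqr.
rewrite [leLHS](_ : _ = \sum_j f j ^+ 2 + (\sum_j f j * g j) *+ 2 + \sum_j g j ^+ 2).
  by rewrite lerD2r lerD2l lerMn2r.
by rewrite -sumrMnl -!big_split/=; apply: eq_bigr => j _; rewrite sqrrD.
Qed.

Lemma fnormZ (c : R) f : fnorm (fun j => c * f j) = `|c| * fnorm f.
Proof.
rewrite /fnorm; under eq_bigr do rewrite exprMn.
by rewrite -mulr_sumr sqrtrM ?sqr_ge0// sqrtr_sqr.
Qed.

Lemma fnorm0 : fnorm (fun=> 0) = 0.
Proof. by rewrite /fnorm big1 ?sqrtr0// => j _; rewrite expr0n. Qed.

Lemma fnorm_sum n (F : 'I_n -> J -> R) :
  fnorm (fun j => \sum_(i < n) F i j) <= \sum_(i < n) fnorm (F i).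
Proof.
elim: n F => [|n IHn] F.
  by rewrite big_ord0 (@eq_fnorm _ (fun=> 0)) ?fnorm0// => j; rewrite big_ord0.
rewrite big_ord_recr/= (@eq_fnorm _ (fun j => \sum_(i < n) F (widen_ord (leqnSn n) i) j + F ord_max j)).
  by rewrite (le_trans (fnormD _ _))// lerD2r.
by move=> j; rewrite big_ord_recr.
Qed.

(** Cauchy-Schwarz with [K] split as a product of two square roots uses the row sums once; after
    exchanging the sums, symmetry turns the column sums into row sums. *)
Lemma schur_test K (c : R) f :
  (forall i j, K i j = K j i) -> (forall i j, 0 <= K i j) ->
  (forall i, \sum_j K i j <= c) -> 0 <= c ->
  fnorm (fun i => \sum_j K i j * f j) <= c * fnorm f.
Proof.
move=> Ksym K0 Kc c0; apply: fnorm_le; first by rewrite mulr_ge0// fnorm_ge0.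
rewrite exprMn fnorm_sqr.
have step i : (\sum_j K i j * f j) ^+ 2 <= c * \sum_j K i j * f j ^+ 2.
  have := sum_mul_sqr_le (fun j => Num.sqrt (K i j)) (fun j => Num.sqrt (K i j) * f j).
  under eq_bigr do rewrite mulrA -expr2 sqr_sqrtr//.
  under [X in _ <= X * _ -> _]eq_bigr do rewrite sqr_sqrtr//.
  under [X in _ <= _ * X -> _]eq_bigr do rewrite exprMn sqr_sqrtr//.
  move=> /le_trans; apply; apply: ler_wpM2r => //.
  by apply: sumr_ge0 => j _; rewrite mulr_ge0 ?sqr_ge0.
apply: le_trans (ler_sum _ (fun i _ => step i)) _.
rewrite -mulr_sumr expr2 -mulrA ler_wpM2l// exchange_big/= mulr_sumr.
apply: ler_sum => j _; rewrite -mulr_suml ler_wpM2r ?sqr_ge0//.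
by under eq_bigr do rewrite Ksym.
Qed.

End FiniteNorm.

(** * Power inequalities behind the commutator bound and its recursion *)

Section NatPowers.
Variable R : realFieldType.

(** The power lies above its tangent line; each induction step discards a nonnegative term of order
    [h ^+ 2]. *)
Lemma ler_expD_bernoulli (x h : R) k : 0 <= x -> 0 <= h ->
  x ^+ k + h * (k%:R * x ^+ k.-1) <= (x + h) ^+ k.
Proof.
move=> x0 h0; elim: k => [|k IHk]; first by rewrite !expr0 mul0r mulr0 addr0.
rewrite [leRHS]exprSr; have := ler_wpM2r (addr_ge0 x0 h0) IHk; apply: le_trans.
have -> : x ^+ k.+1 + h * (k.+1%:R * x ^+ k.+1.-1) = x ^+ k * x + h * (k%:R * x ^+ k + x ^+ k).
  by rewrite exprSr -natr1 /=; ring.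
have -> : k%:R * x ^+ k = k%:R * x ^+ k.-1 * x :> R.
  by case: k {IHk} => [|k]; rewrite ?mul0r// -mulrA -exprSr.
rewrite -subr_ge0 [X in 0 <= X](_ : _ = h ^+ 2 * (k%:R * x ^+ k.-1)); last by ring.
by rewrite mulr_ge0 ?sqr_ge0// mulr_ge0 ?exprn_ge0.
Qed.

Lemma sum_binomial_lt (x : R) k :
  \sum_(j < k) 'C(k, j)%:R * x ^+ j = (x + 1) ^+ k - x ^+ k.
Proof.
rewrite [x + 1]addrC exprDn big_ord_recr/= binn subnn !expr1n mul1r mulr1n addrK.
by apply: eq_bigr => j _; rewrite expr1n mul1r mulr_natl.
Qed.

(* [(s + k) ^+ k] is a supersolution of the Touchard recursion
   [T_k' = \sum_(j < k) 'C(k, j) T_j]. *)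
Lemma touchard_supersolution (s h : R) k : 0 <= s -> 0 <= h ->
  (s + k%:R) ^+ k + h * (\sum_(j < k) 'C(k, j)%:R * (s + j%:R) ^+ j)
    <= (s + h + k%:R) ^+ k.
Proof.
move=> s0 h0; rewrite [s + h + _]addrAC.
apply: le_trans (ler_expD_bernoulli k (addr_ge0 s0 (ler0n _ k)) h0).
rewrite lerD2l ler_wpM2l//; case: k => [|k]; first by rewrite big_ord0 mul0r.
have y0 : 0 <= s + k%:R by rewrite addr_ge0.
(* Raising every base to [s + k] closes the sum to [y ^+ k.+1 - (y - 1) ^+ k.+1] with
   [y = s + k.+1]. This factors into [k.+1] terms, each at most [y ^+ k]. *)
apply: (@le_trans _ _ (\sum_(j < k.+1) 'C(k.+1, j)%:R * (s + k%:R) ^+ j)).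
  apply: ler_sum => j _; rewrite ler_wpM2l// lerXn2r ?nnegrE ?addr_ge0//.
  by rewrite lerD2l ler_nat -ltnS.
rewrite sum_binomial_lt.
have -> : s + k%:R + 1 = s + k.+1%:R by rewrite -natr1 addrA.
set y := s + k.+1%:R.
have -> : s + k%:R = y - 1 by rewrite /y -natr1; ring.
rewrite subrXX opprB addrCA subrr addr0 mul1r.
rewrite [leRHS]mulr_natl -[X in _ *+ X](card_ord k.+1) -sumr_const; apply: ler_sum => i _ /=.
have y1 : 0 <= y - 1 by rewrite /y -natr1 addrA addrK.
have yy : 0 <= y by lra.
rewrite -[X in _ <= y ^+ X](subnK (ltnSE (ltn_ord i))) [leRHS]exprD.
by rewrite ler_wpM2l ?exprn_ge0// lerXn2r ?nnegrE//; lra.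
Qed.

(** The right side is the forward difference of the power at [b]. It dominates the case [b <= a] by
    monotonicity and the case [b = a.+1] by convexity. Only [b] appears in it, so in the commutator
    the weights stay with the vector. *)
Lemma ler_exp_dist (a b k : nat) : (a <= b.+1)%N -> (b <= a.+1)%N ->
  `|a%:R ^+ k - b%:R ^+ k| <= \sum_(j < k) 'C(k, j)%:R * b%:R ^+ j :> R.
Proof.
move=> ab ba; rewrite sum_binomial_lt; have b0 : 0 <= b%:R :> R by [].
have [le_ba|lt_ab] := leqP b a.
  rewrite ger0_norm; last by rewrite subr_ge0 lerXn2r ?nnegrE// ler_nat.
  by rewrite lerD2r lerXn2r ?nnegrE ?addr_ge0// natr1 ler_nat.
have -> : b = a.+1 by apply/eqP; rewrite eqn_leq ba.
rewrite ler0_norm; last by rewrite subr_le0 lerXn2r ?nnegrE// ler_nat.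
rewrite opprB -natr1.
have a0 : 0 <= a%:R :> R by [].
(* What remains is that the second difference of the power at [a] is nonnegative. *)
rewrite -subr_ge0; elim: k => [|k IHk]; first by rewrite !expr0; lra.
have h1 : (a%:R + 1) ^+ k <= (a%:R + 1 + 1) ^+ k :> R.
  by apply: lerXn2r; rewrite ?nnegrE; lra.
move: h1 IHk; rewrite !exprSr; set x := a%:R ^+ k; set y := (a%:R + 1) ^+ k.
set z := (_ + 1 + 1) ^+ k => yz H.
by have := mulr_ge0 a0 H; lra.
Qed.

End NatPowers.

(** Trinomial revision: after multiplication by the three factorials, both sides become [r!]. *)
Lemma mul_binomial (r q k : nat) : (q + k <= r)%N ->
  ('C(r, q + k) * 'C(q + k, q) = 'C(r, q) * 'C(r - q, k))%N.
Proof.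
move=> qkr; have qr : (q <= r)%N := leq_trans (leq_addr k q) qkr.
have krq : (k <= r - q)%N by rewrite leq_subRL.
have h1 := bin_fact qkr; have h2 := bin_fact (leq_addr k q).
have h3 := bin_fact qr; have h4 := bin_fact krq.
rewrite addKn in h2; rewrite -subnDA in h4.
have f0 : (0 < q`! * k`! * (r - (q + k))`!)%N by rewrite !muln_gt0 !fact_gt0.
apply/eqP; rewrite -(eqn_pmul2r f0); apply/eqP.
transitivity r`!.
  by rewrite -h1 -h2; ring.
by rewrite -h3 -h4; ring.
Qed.

(** Exchanging the sums, putting [j = k + q] and applying trinomial revision collects the
    coefficient of each [a q]. That coefficient is the sum in the Touchard recursion of order
    [r - q]. *)
Lemma sum_binomial_convolution (R : comPzRingType) (U a : nat -> R) r :
  \sum_(j < r) 'C(r, j)%:R * (\sum_(q < j.+1) 'C(j, q)%:R * U (j - q)%N * a q) =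
  \sum_(q < r.+1) 'C(r, q)%:R * (\sum_(k < r - q) 'C(r - q, k)%:R * U k) * a q.
Proof.
transitivity (\sum_(j < r) \sum_(q < r.+1) 'C(r, j)%:R * ('C(j, q)%:R * U (j - q)%N * a q)).
  apply: eq_bigr => j _; rewrite mulr_sumr.
  rewrite (big_ord_widen r.+1 (fun q => 'C(r, j)%:R * ('C(j, q)%:R * U (j - q)%N * a q))) ?ltnS 1?ltnW//.
  rewrite big_mkcond/=; apply: eq_bigr => q _; rewrite ltnS; case: leqP => // jq.
  by rewrite (bin_small jq) !mul0r mulr0.
rewrite exchange_big/=; apply: eq_bigr => q _; rewrite mulr_sumr mulr_suml.
rewrite -(big_mkord xpredT (fun j => 'C(r, j)%:R * ('C(j, q)%:R * U (j - q)%N * a q))).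
rewrite (@big_cat_nat _ _ _ q)//=; last by rewrite -ltnS.
rewrite big1_seq ?add0r; last first.
  by move=> j; rewrite mem_index_iota => /= jq; rewrite (bin_small jq) !mul0r mulr0.
rewrite -{1}(add0n (q : nat)) big_addn big_mkord; apply: eq_bigr => k _.
rewrite addnK !mulrA -!natrM [(k + q)%N]addnC mul_binomial; last by rewrite ltnW// -ltn_subRL.
by [].
Qed.

(** * Weighted growth under Euler steps of a finite antisymmetric matrix *)

Section AntisymmetricEuler.
Variables (R : rcfType) (J : finType) (K : J -> J -> R) (d : J -> nat).
Variables (D B h : R).
Hypothesis K_anti : forall i j, K i j = - K j i.
Hypothesis K_bnd : forall i, \sum_j `|K i j| <= B.
Hypothesis K_off : forall i, \sum_(j | d j != d i) `|K i j| <= D.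
Hypothesis K_loc : forall i j, K i j != 0 -> (d i <= (d j).+1)%N.
Hypotheses (B_ge0 : 0 <= B) (D_ge0 : 0 <= D) (h_ge0 : 0 <= h).

Definition kmul (u : J -> R) : J -> R := fun i => \sum_j K i j * u j.
Definition euler_step (u : J -> R) : J -> R := fun i => u i + h * kmul u i.
Definition weight r (u : J -> R) : J -> R := fun i => (d i)%:R ^+ r * u i.

Lemma fnorm_kmul u : fnorm (kmul u) <= B * fnorm u.
Proof.
apply: le_trans (_ : _ <= fnorm (fun i => \sum_j `|K i j| * `|u j|)) _.
  apply: ler_fnorm => i; rewrite [leRHS]ger0_norm; last by apply: sumr_ge0 => j _; rewrite mulr_ge0.
  by rewrite (le_trans (ler_norm_sum _ _ _))//; apply: ler_sum => j _; rewrite normrM.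
have -> : fnorm u = fnorm (fun j => `|u j|).
  by apply/eqP; rewrite eq_le !ler_fnorm// => j; rewrite normr_id.
by apply: schur_test => // i j; rewrite K_anti normrN.
Qed.

Lemma kmul_orth u : \sum_i u i * kmul u i = 0.
Proof.
suff : \sum_i u i * kmul u i = - \sum_i u i * kmul u i by lra.
rewrite -sumrN /kmul.
under eq_bigr do rewrite mulr_sumr.
rewrite exchange_big/=; apply: eq_bigr => i _; rewrite mulr_sumr -sumrN.
by apply: eq_bigr => j _; rewrite K_anti; ring.
Qed.

(** Since [kmul u] is orthogonal to [u], the squared norm has no cross term and the loss is
    quadratic in [h]. Bounding [1 + y] by [(1 + y) ^+ 2] spares a square root in the factor. *)
Lemma fnorm_euler_step u : fnorm (euler_step u) <= (1 + (h * B) ^+ 2) * fnorm u.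
Proof.
have c0 : 0 <= (h * B) ^+ 2 by rewrite sqr_ge0.
apply: fnorm_le; first by rewrite mulr_ge0 ?fnorm_ge0// addr_ge0.
rewrite (_ : \sum_j _ = fnorm u ^+ 2 + h ^+ 2 * fnorm (kmul u) ^+ 2); last first.
  rewrite !fnorm_sqr mulr_sumr -big_split/=; apply/eqP.
  rewrite -subr_eq0 -sumrB; apply/eqP.
  transitivity (2 * h * \sum_i u i * kmul u i); last by rewrite kmul_orth mulr0.
  by rewrite mulr_sumr; apply: eq_bigr => i _; rewrite /euler_step; ring.
have : fnorm (kmul u) ^+ 2 <= (B * fnorm u) ^+ 2.
  by rewrite lerXn2r ?nnegrE ?mulr_ge0 ?fnorm_ge0 ?fnorm_kmul.
move/(ler_wpM2l (sqr_ge0 h)) => kb.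
apply: le_trans (_ : _ <= (1 + (h * B) ^+ 2) * fnorm u ^+ 2) _.
  by rewrite mulrDl mul1r lerD2l (le_trans kb)// !exprMn mulrA.
by rewrite [leRHS]exprMn ler_wpM2r ?sqr_ge0// [leRHS]expr2 ler_peMl ?addr_ge0// lerDl.
Qed.

(** The commutator has entries [K i j * ((d i)%:R ^+ r - (d j)%:R ^+ r)], which vanish when
    [d i = d j]. Hence the Schur test sees only the row sums bounded by [D], not those bounded by
    [B]. *)
Lemma fnorm_commutator r u :
  fnorm (fun i => (d i)%:R ^+ r * kmul u i - kmul (weight r u) i)
    <= D * \sum_(j < r) 'C(r, j)%:R * fnorm (weight j u).
Proof.
pose k i j := if d j != d i then `|K i j| else 0.
pose v j := \sum_(q < r) 'C(r, q)%:R * `|weight q u j|.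
have k0 i j : 0 <= k i j by rewrite /k; case: ifP.
have v0 j : 0 <= v j by apply: sumr_ge0 => q _; rewrite mulr_ge0.
apply: (@le_trans _ _ (fnorm (fun i => \sum_j k i j * v j))).
  apply: ler_fnorm => i; rewrite [leRHS]ger0_norm; last by apply: sumr_ge0 => j _; rewrite mulr_ge0.
  rewrite /kmul mulr_sumr -sumrB (le_trans (ler_norm_sum _ _ _))//.
  apply: ler_sum => j _; rewrite /k; have [Edd|_] /= := eqVneq (d j) (d i).
    by rewrite /weight Edd mulrCA subrr normr0 mul0r.
  have [->|Kij] := eqVneq (K i j) 0; first by rewrite !mul0r mulr0 subrr normr0 mul0r.
  have Kji : K j i != 0 by rewrite K_anti oppr_eq0.
  rewrite [X in `|X|](_ : _ = K i j * (((d i)%:R ^+ r - (d j)%:R ^+ r) * u j)); last by rewrite /weight; ring.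
  rewrite !normrM ler_wpM2l//.
  apply: le_trans (ler_wpM2r (normr_ge0 _) (ler_exp_dist R r (K_loc Kij) (K_loc Kji))) _.
  rewrite mulr_suml; apply: ler_sum => q _.
  by rewrite -mulrA ler_wpM2l// /weight normrM ger0_norm ?exprn_ge0.
have ksym i j : k i j = k j i by rewrite /k eq_sym K_anti normrN.
have kD i : \sum_j k i j <= D by rewrite /k -big_mkcond.
apply: le_trans (schur_test v ksym k0 kD D_ge0) _; rewrite ler_wpM2l//.
apply: le_trans (fnorm_sum _) _; apply: ler_sum => q _.
rewrite fnormZ ger0_norm// ler_wpM2l// ler_fnorm// => j; by rewrite normr_id.
Qed.

Lemma fnorm_weight_euler_step r u :
  fnorm (weight r (euler_step u)) <= (1 + (h * B) ^+ 2) * fnorm (weight r u)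
    + h * D * \sum_(j < r) 'C(r, j)%:R * fnorm (weight j u).
Proof.
rewrite (@eq_fnorm _ _ _ (fun i => euler_step (weight r u) i +
   h * ((d i)%:R ^+ r * kmul u i - kmul (weight r u) i))); last first.
  by move=> i; rewrite /weight /euler_step; ring.
apply: le_trans (fnormD _ _) _; rewrite lerD ?fnorm_euler_step//.
by rewrite fnormZ ger0_norm// -mulrA ler_wpM2l// fnorm_commutator.
Qed.

(** Induction on the number of steps, for all orders [r] at once, because the commutator feeds the
    lower orders into the order [r]. *)
Lemma fnorm_weight_euler r n u :
  fnorm (weight r (iter n euler_step u)) <= (1 + (h * B) ^+ 2) ^+ n *
    \sum_(q < r.+1) 'C(r, q)%:R * (D * (n%:R * h) + (r - q)%:R) ^+ (r - q)
      * fnorm (weight q u).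
Proof.
set c := 1 + (h * B) ^+ 2; have c1 : 1 <= c by rewrite lerDl sqr_ge0.
have c0 : 0 <= c := le_trans ler01 c1.
elim: n r => [|n IHn] r.
  rewrite expr0 mul1r mul0r mulr0 big_ord_recr/= binn subnn expr0 !mul1r lerDr.
  by apply: sumr_ge0 => q _; rewrite !mulr_ge0 ?fnorm_ge0 ?exprn_ge0 ?addr_ge0.
set s := D * (n%:R * h) in IHn; have s0 : 0 <= s by rewrite !mulr_ge0.
have hD0 : 0 <= h * D by rewrite mulr_ge0.
set a := fun q => fnorm (weight q u); have a0 q : 0 <= a q by exact: fnorm_ge0.
pose S m := \sum_(q < m.+1) 'C(m, q)%:R * (s + (m - q)%:R) ^+ (m - q) * a q.
have S0 m : 0 <= S m.
  by apply: sumr_ge0 => q _; rewrite !mulr_ge0 ?exprn_ge0 ?addr_ge0.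
rewrite iterS (le_trans (fnorm_weight_euler_step _ _))//.
apply: (@le_trans _ _ (c ^+ n.+1 * (S r + h * D * \sum_(j < r) 'C(r, j)%:R * S j))).
  rewrite mulrDr lerD//; first by rewrite [c ^+ n.+1]exprS -[leRHS]mulrA ler_wpM2l//; exact: IHn.
  (* The lower orders carry only [c ^+ n]; as [1 <= c], this is enlarged to the common factor
     [c ^+ n.+1]. *)
  rewrite mulrCA ler_wpM2l// mulr_sumr; apply: ler_sum => j _.
  rewrite mulrCA ler_wpM2l// (le_trans (IHn j))//.
  by rewrite -/(S j) ler_wpM2r// exprS ler_peMl ?exprn_ge0.
rewrite ler_wpM2l ?exprn_ge0//.
have -> : D * (n.+1%:R * h) = s + h * D by rewrite /s -natr1; ring.
pose U k := (s + k%:R) ^+ k.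
(* Collected by [q], the claim splits into one Touchard inequality for each [q], with increment
   [h * D] and exponent [r - q]. *)
rewrite (sum_binomial_convolution U).
rewrite /S mulr_sumr -big_split/=; apply: ler_sum => q _.
rewrite mulrA -mulrDl ler_wpM2r// mulrCA -mulrDr ler_wpM2l//.
exact: touchard_supersolution.
Qed.
End AntisymmetricEuler.

(** * Convergence of the Euler scheme *)

Lemma ffact_le_expn n k : (n ^_ k <= n ^ k)%N.
Proof. by elim: k => [|k IHk]//; rewrite ffactnSr expnSr leq_mul// leq_subr. Qed.

(** Replacing the next factor [n] by [n - k] costs at most [k * n ^ k.+1], and
    [k ^ 2 + k <= k.+1 ^ 2]. The extra factor [n] on both sides avoids the exponent [k - 1]. *)
Lemma expn_ffact_defect n k : (n ^ k * n <= n ^_ k * n + k ^ 2 * n ^ k)%N.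
Proof.
elim: k => [|k IHk]; first by rewrite ffactn0 leq_addr.
have h1 : (n ^_ k * n * n <= n ^_ k.+1 * n + k * n ^ k.+1)%N.
  apply: (@leq_trans (n ^_ k.+1 * n + k * (n ^_ k * n))%N); last first.
    by rewrite leq_add2l leq_mul// expnSr leq_mul2r ffact_le_expn orbT.
  rewrite ffactnSr (_ : k * (n ^_ k * n) = n ^_ k * k * n)%N; last by ring.
  have kn : (n <= n - k + k)%N by rewrite addnC -leq_subLR.
  by rewrite -mulnDl leq_mul2r -mulnDr leq_mul2l kn !orbT.
have h2 : (n ^ k.+1 * n <= (n ^_ k * n + k ^ 2 * n ^ k) * n)%N by rewrite expnSr leq_mul2r IHk orbT.
apply: leq_trans h2 _; rewrite mulnDl -[(k ^ 2 * _ * _)%N]mulnA -expnSr; apply: leq_trans (leq_add h1 (leqnn _)) _.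
rewrite -addnA leq_add2l -mulnDl leq_mul2r; apply/orP; right.
by rewrite -(addn1 k) sqrnD addnC -addnA leq_add2l muln1 mul2n -addnn addnCA leq_addr.
Qed.

(** * Binomial sums converging to exponential series, with an explicit rate *)

Section Tannery.
Variable R : realType.

(** The defect of the falling factorial, with [k ^ 2] relaxed to [4 ^ k] so that summation over [k]
    yields an exponential. *)
Lemma binomial_exp_defect n k :
  `|(k`!)%:R^-1 - 'C(n.+1, k)%:R / n.+1%:R ^+ k| <= 4 ^+ k / (k`!)%:R / n.+1%:R :> R.
Proof.
have k0 : (k`!)%:R != 0 :> R by rewrite pnatr_eq0 -lt0n fact_gt0.
have n0 : n.+1%:R != 0 :> R by rewrite pnatr_eq0.
have -> : (k`!)%:R^-1 - 'C(n.+1, k)%:R / n.+1%:R ^+ k =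
   (n.+1%:R ^+ k - (n.+1 ^_ k)%:R) / (k`!)%:R / n.+1%:R ^+ k :> R.
  by rewrite -bin_ffact natrM; move: n0; set N := n.+1%:R => n0; field; rewrite k0 expf_neq0.
rewrite ger0_norm; last first.
  by rewrite !divr_ge0 ?exprn_ge0// subr_ge0 -natrX ler_nat ffact_le_expn.
rewrite ler_pdivrMr ?exprn_gt0// mulrAC [leRHS](_ : _ = (4 ^+ k * n.+1%:R ^+ k / n.+1%:R) / (k`!)%:R); last by ring.
rewrite ler_wpM2r ?invr_ge0// ler_pdivlMr// mulrBl lerBlDl.
have k4 : (k ^ 2 <= 4 ^ k)%N by rewrite (_ : 4 = 2 ^ 2)%N// -expnM mulnC expnM leq_exp2r// ltnW// ltn_expl.
have := expn_ffact_defect n.+1 k; rewrite -(ler_nat R) natrD !natrM !natrX => /le_trans; apply.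
by rewrite lerD2l ler_wpM2r ?exprn_ge0// -expr2 -!natrX ler_nat.
Qed.

Lemma series_exp_coeff_le (x : R) n : 0 <= x -> series (exp_coeff x) n <= expR x.
Proof.
move=> x0; apply: nondecreasing_cvgn_le; last exact: is_cvg_series_exp_coeff.
by apply: nondecreasing_series => k _ _; exact: exp_coeff_ge0.
Qed.

(** The binomial sum is compared with the partial sum of the same length. The termwise defects add
    up to at most [M * expR (4 * B)] times [harmonic n]. *)
Lemma cvg_binomial_exp (c : R^nat) (M B : R) : 0 <= M -> 0 <= B ->
  (forall k, `|c k| <= M * B ^+ k) ->
  cvgn (series (fun k => c k / (k`!)%:R)) /\
  (fun n => \sum_(k < n.+2) 'C(n.+1, k)%:R / n.+1%:R ^+ k * c k) @ \oo -->
    limn (series (fun k => c k / (k`!)%:R)).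
Proof.
move=> M0 B0 cb; set s := series _.
have cs : cvgn s.
  apply: normed_cvg; apply: (@series_le_cvg _ _ (fun k => M * exp_coeff B k)).
  - by move=> k; exact: normr_ge0.
  - by move=> k; rewrite mulr_ge0// exp_coeff_ge0.
  - by move=> k /=; rewrite normrM normfV (ger0_norm (ler0n _ _)) /exp_coeff/= mulrA ler_wpM2r// invr_ge0.
  - exact: (is_cvg_seriesZ (k := M) (is_cvg_series_exp_coeff B)).
split => //; set E := fun n => _.
have dE n : `|s n.+2 - E n| <= M * expR (4 * B) * harmonic n.
  rewrite /s /E /series/= big_mkord -sumrB (le_trans (ler_norm_sum _ _ _))//.
  apply: (@le_trans _ _ (\sum_(k < n.+2) M * exp_coeff (4 * B) k / n.+1%:R)).
    apply: ler_sum => k _; rewrite mulrC -mulrBl normrM.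
    apply: le_trans (ler_pM _ _ (binomial_exp_defect n k) (cb k)) _ => //.
    by rewrite /exp_coeff/= exprMn le_eqVlt; apply/orP; left; apply/eqP; ring.
  rewrite -mulr_suml -mulr_sumr /harmonic ler_wpM2r ?invr_ge0// ler_wpM2l//.
  have := @series_exp_coeff_le (4 * B) n.+2; rewrite /series/= big_mkord; apply.
  by rewrite mulr_ge0.
(* The power [n.+1] expands into [n.+2] terms, hence the shift by two. *)
have cs2 : s \o (addn^~ 2%N) @ \oo --> limn s by rewrite -[X in X @ _](_ : [sequence s (n + 2)%N]_n = _)// cvg_shiftn.
have d0 : (fun n => s n.+2 - E n) @ \oo --> (0 : R).
  apply/norm_cvg0P; rewrite /=.
  apply: (@squeeze_cvgr _ _ _ _ (fun=> 0) (fun n => M * expR (4 * B) * harmonic n)).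
  - by near=> n; rewrite normr_ge0 dE.
  - exact: cvg_cst.
  - by rewrite -[X in _ --> X](mulr0 (M * expR (4 * B))); apply: cvgMr; exact: cvg_harmonic.
suff -> : E = (s \o (addn^~ 2%N)) - (fun n => s n.+2 - E n).
  by have H := cvgB cs2 d0; rewrite subr0 in H; exact: H.
by apply/funext => n; rewrite !fctE/= addn2 subKr.
Unshelve. all: by end_near. Qed.

Lemma complex_cvg (u : nat -> (R[i] : numClosedFieldType)) (a b : R) :
  (fun n => complex.Re (u n)) @ \oo --> a -> (fun n => complex.Im (u n)) @ \oo --> b ->
  limn u = Complex a b.
Proof.
move=> /cvgrPdist_lt ua /cvgrPdist_lt ub; apply: cvg_lim; first exact: norm_hausdorff.
(* Positivity in the order of [R[i]] forces the radius to be real. *)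
apply/cvgrPdist_lt => -[eps ieps]; rewrite ltcE /= => /andP[/eqP-> eps0].
have e2 : 0 < eps / 2 by rewrite divr_gt0.
near=> n.
have A : `|a - complex.Re (u n)| < eps / 2 by near: n; exact: ua.
have C : `|b - complex.Im (u n)| < eps / 2 by near: n; exact: ub.
rewrite normc_def ltcR; case: (u n) A C => x y /=; set p := a - x; set q := b - y => A C.
rewrite -(@ltr_pXn2r _ 2)// ?nnegrE ?sqrtr_ge0 ?(ltW eps0)// sqr_sqrtr ?addr_ge0 ?sqr_ge0//.
have h (z : R) : `|z| < eps / 2 -> z ^+ 2 < (eps / 2) ^+ 2.
  by move=> hz; rewrite -(real_normK (num_real z)) ltr_pXn2r ?nnegrE// ltW.
by have := h _ A; have := h _ C; rewrite expr_div_n; nra.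
Unshelve. all: by end_near. Qed.

End Tannery.

(** Pascal's rule in summed form, the induction step for expanding powers of [1 + w H]. *)
Lemma sum_binS (K : pzRingType) (f : nat -> K) n :
  \sum_(k < n.+2) 'C(n.+1, k)%:R * f k =
  \sum_(k < n.+1) 'C(n, k)%:R * (f k + f k.+1).
Proof.
rewrite big_ord_recl bin0 /=.
under eq_bigr do rewrite /bump add1n binS natrD mulrDl.
under [RHS]eq_bigr do rewrite mulrDr.
rewrite !big_split/= addrA; congr (_ + _).
rewrite [RHS]big_ord_recl bin0/= big_ord_recr/= bin_small// mul0r addr0.
by congr (_ + _); apply: eq_bigr => k _; rewrite /bump add1n.
Qed.

(** * Real and imaginary parts *)

Section Components.
Local Open Scope complex_scope.
Variable R : realType.

Lemma Re_sum (I : Type) (s : seq I) (F : I -> R[i]) :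
  complex.Re (\sum_(i <- s) F i) = \sum_(i <- s) complex.Re (F i).
Proof. by apply: (big_morph (@complex.Re R)) => // -[? ?] [? ?]. Qed.

Lemma Im_sum (I : Type) (s : seq I) (F : I -> R[i]) :
  complex.Im (\sum_(i <- s) F i) = \sum_(i <- s) complex.Im (F i).
Proof. by apply: (big_morph (@complex.Im R)) => // -[? ?] [? ?]. Qed.

Lemma Re_realM (a : R) (z : R[i]) : complex.Re (a%:C * z) = a * complex.Re z.
Proof. by case: z => x y /=; rewrite mul0r subr0. Qed.

Lemma Im_realM (a : R) (z : R[i]) : complex.Im (a%:C * z) = a * complex.Im z.
Proof. by case: z => x y /=; rewrite mul0r addr0. Qed.

(** The bound is componentwise because the two parts go separately through real convergence results,
    and multiplication by [- 'i] swaps them up to sign. *)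
Definition cbnd (N : R) (z : R[i]) : Prop :=
  `|complex.Re z| <= N /\ `|complex.Im z| <= N.

Lemma cbnd_sum (I : Type) (s : seq I) (F : I -> R[i]) (N : R) :
  (forall i, cbnd N (F i)) -> cbnd ((size s)%:R * N) (\sum_(i <- s) F i).
Proof.
move=> FN.
have sN : \sum_(i <- s) N = (size s)%:R * N by rewrite big_const_seq count_predT iter_addr_0 mulr_natl.
split; rewrite ?Re_sum ?Im_sum (le_trans (ler_norm_sum _ _ _))// -sN;
  apply: ler_sum => i _; by case: (FN i).
Qed.

Lemma cbndD (M N : R) (z w : R[i]) : cbnd M z -> cbnd N w -> cbnd (M + N) (z + w).
Proof.
case: z => a b; case: w => c d [/= h1 h2] [/= h3 h4].
by split; rewrite /= (le_trans (ler_normD _ _))// lerD.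
Qed.

Lemma cbnd_realM (a c N : R) (z : R[i]) : `|a| <= c -> cbnd N z -> cbnd (c * N) (a%:C * z).
Proof. by move=> ac [h1 h2]; split; rewrite ?Re_realM ?Im_realM normrM ler_pM. Qed.

Lemma ReNiM (z : R[i]) : complex.Re (- 'i%R * z) = complex.Im z.
Proof. by case: z => x y /=; rewrite oppr0 mul0r add0r mulN1r opprK. Qed.

Lemma ImNiM (z : R[i]) : complex.Im (- 'i%R * z) = - complex.Re z.
Proof. by case: z => x y /=; rewrite oppr0 mul0r add0r mulN1r. Qed.

Lemma cbnd_NiM (N : R) (z : R[i]) : cbnd N z -> cbnd N (- 'i%R * z).
Proof. by case=> h1 h2; split; rewrite ?ReNiM// ImNiM normrN. Qed.

End Components.

(** * The operator on the graph and its Euler iterates *)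

Section Graph.
Local Open Scope complex_scope.
Variables (R : realType) (T : countType) (e : rel T) (D : nat) (V : T -> R) (C : R).
Hypothesis deg_le : forall (x : T) (s : seq T), uniq s -> all (e x) s -> (size s <= D)%N.
Hypothesis V_bnd : forall x, `|V x| <= C.

Definition nbrs (x : T) : {fset T} := fset_set [set y | e x y].

(** An infinite neighbourhood would contain [D.+1] distinct neighbours. Finiteness turns the sum in
    [Hop] into one over a concrete duplicate-free list. *)
Lemma finite_nbrs x : finite_set [set y | e x y].
Proof.
apply: contrapT => /(@infinite_set_fset _ _ D.+1)[s sx].
have := deg_le (fset_uniq s) (_ : all (e x) s).
by rewrite ltnNge => -> //; apply/allP => y ys; exact: sx.
Qed.

Lemma in_nbrs x y : (y \in nbrs x) = e x y.
Proof. by rewrite in_fset_set ?mem_setE//; exact: finite_nbrs. Qed.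

Lemma size_nbrs x : (size (nbrs x) <= D)%N.
Proof. by apply: (@deg_le x); rewrite ?fset_uniq//; apply/allP => y; rewrite in_nbrs. Qed.

Lemma HopE (phi : T -> R[i]) x :
  Hop e V phi x = \sum_(y <- nbrs x) phi y + (V x)%:C * phi x.
Proof. by rewrite /Hop fsbig_finite//; exact: finite_nbrs. Qed.

Lemma HopD (phi chi : T -> R[i]) a :
  Hop e V (fun x => phi x + a * chi x) = fun x => Hop e V phi x + a * Hop e V chi x.
Proof.
apply/funext => x; rewrite !HopE big_split/= -mulr_sumr; ring.
Qed.

Lemma iter_HopD k (phi chi : T -> R[i]) a :
  iter k (Hop e V) (fun x => phi x + a * chi x) =
  fun x => iter k (Hop e V) phi x + a * iter k (Hop e V) chi x.
Proof. by elim: k => //= k ->; rewrite HopD. Qed.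

Definition Hop_euler (w : R[i]) (phi : T -> R[i]) : T -> R[i] :=
  fun x => phi x + w * Hop e V phi x.

(** The binomial theorem for [(1 + w H)^n]: the innermost step is peeled off by linearity, then
    Pascal's rule applies. *)
Lemma iter_Hop_euler w n (psi : T -> R[i]) x :
  iter n (Hop_euler w) psi x =
  \sum_(k < n.+1) 'C(n, k)%:R * (w ^+ k * iter k (Hop e V) psi x).
Proof.
elim: n psi x => [|n IHn] psi x.
  by rewrite big_ord_recl big_ord0 bin0 !mul1r addr0.
rewrite iterSr IHn (sum_binS (fun k => w ^+ k * iter k (Hop e V) psi x)).
apply: eq_bigr => k _; congr (_ * _).
by rewrite /Hop_euler iter_HopD mulrDr exprSr -iterSr mulrA.
Qed.

(** Each application of [H] adds at most [D] neighbouring values and one value scaled by at most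
    [C]. The resulting geometric growth is what the exponential limit requires. *)
Lemma iter_Hop_bnd (M : R) (psi : T -> R[i]) : (forall x, cbnd M (psi x)) ->
  forall k x, cbnd (M * (D%:R + C) ^+ k) (iter k (Hop e V) psi x).
Proof.
move=> psiM; elim=> [|k IHk] x; first by rewrite mulr1.
rewrite iterS HopE; set N := M * (D%:R + C) ^+ k in IHk.
have N0 : 0 <= N by case: (IHk x) => /(le_trans (normr_ge0 _)).
have -> : M * (D%:R + C) ^+ k.+1 = D%:R * N + C * N by rewrite /N exprSr; ring.
apply: cbndD; last exact: cbnd_realM.
have [h1 h2] := cbnd_sum (nbrs x) IHk.
have le : (size (nbrs x))%:R * N <= D%:R * N by rewrite ler_wpM2r// ler_nat size_nbrs.
by split; [apply: le_trans h1 le|apply: le_trans h2 le].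
Qed.

(** With [c k = (-it)^k H^k psi(x)], the Euler iterate is the binomial sum of the [c k] and the
    evolution is their exponential series. The two are compared for each component separately. *)
Lemma evol_cvg (t M : R) (psi : T -> R[i]) x : 0 <= t -> (forall x, cbnd M (psi x)) ->
  let E n := iter n.+1 (Hop_euler (- 'i%R * (t / n.+1%:R)%:C)) psi x in
  (fun n => complex.Re (E n)) @ \oo --> complex.Re (evol e V t psi x) /\
  (fun n => complex.Im (E n)) @ \oo --> complex.Im (evol e V t psi x).
Proof.
move=> t0 psiM E.
have M0 : 0 <= M by case: (psiM x) => /(le_trans (normr_ge0 _)).
have C0 : 0 <= C := le_trans (normr_ge0 _) (V_bnd x).
set B := D%:R + C; have B0 : 0 <= B by rewrite addr_ge0.
pose c k : R[i] := (- 'i%R * t%:C) ^+ k * iter k (Hop e V) psi x.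
have cb k : cbnd (M * (t * B) ^+ k) (c k).
  have -> : M * (t * B) ^+ k = t ^+ k * (M * B ^+ k) by rewrite exprMn; ring.
  rewrite /c; have := iter_Hop_bnd psiM k x; rewrite -/B.
  move: (iter k _ _ _) (M * _) => z N zN.
  elim: k => [|k IHk]; first by rewrite !mul1r.
  rewrite !exprS -!mulrA; apply: cbnd_NiM; apply: cbnd_realM => //.
  by rewrite ger0_norm.
have Ec n : E n = \sum_(k < n.+2) ('C(n.+1, k)%:R / n.+1%:R ^+ k)%:C * c k.
  rewrite /E iter_Hop_euler; apply: eq_bigr => k _.
  rewrite /c mulrA mulrA; congr (_ * _).
  rewrite !rmorphM/= exprMn exprMn rmorph_nat !fmorphV/= rmorphXn/= rmorph_nat exprVn.
  by rewrite [(- _ * _) ^+ k]exprMn -mulrA; congr (_ * _); rewrite mulrA mulrC.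
have [reb imb] : (forall k, `|complex.Re (c k)| <= M * (t * B) ^+ k) /\ (forall k, `|complex.Im (c k)| <= M * (t * B) ^+ k).
  by split=> k; case: (cb k).
have tB0 : 0 <= t * B by rewrite mulr_ge0.
have [rc rl] := cvg_binomial_exp M0 tB0 reb.
have [ic il] := cvg_binomial_exp M0 tB0 imb.
have sE n : (- 'i%R * t%:C) ^+ n / (n`!)%:R * iter n (Hop e V) psi x = ((n`!)%:R^-1)%:C * c n.
  by rewrite /c mulrAC mulrC fmorphV rmorph_nat.
have evE : evol e V t psi x = Complex (limn (series (fun k => complex.Re (c k) / (k`!)%:R)))
   (limn (series (fun k => complex.Im (c k) / (k`!)%:R))).
  apply: complex_cvg.
    suff -> : (fun n => complex.Re (series (fun n => (- 'i%R * t%:C) ^+ n / (n`!)%:R * iter n (Hop e V) psi x) n)) = series (fun k => complex.Re (c k) / (k`!)%:R) by [].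
    by apply/funext => n; rewrite /series/= Re_sum; apply: eq_bigr => k _; rewrite sE Re_realM mulrC.
  suff -> : (fun n => complex.Im (series (fun n => (- 'i%R * t%:C) ^+ n / (n`!)%:R * iter n (Hop e V) psi x) n)) = series (fun k => complex.Im (c k) / (k`!)%:R) by [].
  by apply/funext => n; rewrite /series/= Im_sum; apply: eq_bigr => k _; rewrite sE Im_realM mulrC.
rewrite evE/=; split.
  suff -> : (fun n => complex.Re (E n)) = (fun n => \sum_(k < n.+2) 'C(n.+1, k)%:R / n.+1%:R ^+ k * complex.Re (c k)) by [].
  by apply/funext => n; rewrite Ec Re_sum; apply: eq_bigr => k _; rewrite Re_realM.
suff -> : (fun n => complex.Im (E n)) = (fun n => \sum_(k < n.+2) 'C(n.+1, k)%:R / n.+1%:R ^+ k * complex.Im (c k)) by [].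
by apply/funext => n; rewrite Ec Im_sum; apply: eq_bigr => k _; rewrite Im_realM.
Qed.
End Graph.

(** * Truncation to finite vertex sets *)

Section Distance.
Variables (T : countType) (e : rel T) (o : T).
Hypothesis e_conn : forall x : T, exists n : nat, walk_len e o x n.

Lemma gdistP x : walk_len e o x (gdist e o x) /\
  forall k, walk_len e o x k -> (gdist e o x <= k)%N.
Proof.
(* The default value 0 of [xget] would require that no shortest walk exists, which connectedness
   excludes. *)
rewrite /gdist; case: xgetP => [n _ //|noP]; exfalso.
have [n xn] := e_conn x.
pose P k := `[< walk_len e o x k >].
have [k /asboolP xk kmin] := ex_minnP (ex_intro P n (asboolT xn)).
by apply: (noP k); split=> // l xl; apply: kmin; apply/asboolP.
Qed.

Lemma gdist_adj x y : e x y -> (gdist e o y <= (gdist e o x).+1)%N.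
Proof.
move=> exy; have [[p [sp pp lp]] _] := gdistP x.
apply: (gdistP y).2; exists (rcons p y); split.
- by rewrite size_rcons sp.
- by rewrite rcons_path pp lp.
- by rewrite last_rcons.
Qed.
End Distance.

(** * Finite compressions of the operator and passage to the limit *)

Section Truncation.
Local Open Scope complex_scope.
Variables (R : realType) (T : countType) (e : rel T) (D : nat) (V : T -> R) (C : R).
Variable o : T.
Hypothesis e_sym : symmetric e.
Hypothesis e_conn : forall x : T, exists n : nat, walk_len e o x n.
Hypothesis deg_le : forall (x : T) (s : seq T), uniq s -> all (e x) s -> (size s <= D)%N.
Hypothesis V_bnd : forall x, `|V x| <= C.

Let nbrs := nbrs e.

(** The closed neighbourhood of [s]: one Euler step evaluated on [s] depends only on values
    there. *)
Definition grow (s : seq T) : seq T := s ++ flatten [seq (nbrs x : seq T) | x <- s].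

Lemma sub_grow s : {subset s <= grow s}.
Proof. by move=> x xs; rewrite mem_cat xs. Qed.

Lemma grow_nbrs s x y : x \in s -> e x y -> y \in grow s.
Proof.
move=> xs xy; rewrite mem_cat; apply/orP; right; apply/flattenP.
by exists (nbrs x : seq T); [exact: (map_f (fun x => nbrs x : seq T))|rewrite /= (in_nbrs deg_le)].
Qed.

Lemma sub_iter_grow n m s : (n <= m)%N -> {subset iter n grow s <= iter m grow s}.
Proof.
move=> /subnK <-; elim: (m - n)%N => //= k IHk x /IHk; exact: sub_grow.
Qed.

Section Fin.
Variable S : {fset T}.
Let J : finType := (S * bool)%type.

Definition Hmat (x y : T) : R := (e x y)%:R + (x == y)%:R * V x.

Lemma HmatC x y : Hmat x y = Hmat y x.
Proof. by rewrite /Hmat e_sym eq_sym; case: eqP => [->|]//; rewrite !mul0r. Qed.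

(* [-i H] acting on the pairs (real part, imaginary part), the boolean
   selecting the imaginary part. *)
Definition Kmat (i j : J) : R :=
  if i.2 == j.2 then 0 else (-1) ^+ i.2 * Hmat (val i.1) (val j.1).

Lemma Kmat_anti i j : Kmat i j = - Kmat j i.
Proof.
rewrite /Kmat HmatC eq_sym; case: i j => [x [|]] [y [|]] /=; rewrite ?oppr0//.
  by rewrite expr1 expr0 !mulN1r mul1r.
by rewrite expr1 expr0 !mulN1r mul1r opprK.
Qed.

Lemma sum_pairb (F : J -> R) : \sum_j F j = \sum_(x : S) (F (x, true) + F (x, false)).
Proof.
rewrite (eq_bigr (fun p => F (p.1, p.2))); last by case.
by rewrite -(pair_bigA _ (fun x b => F (x, b)))/=; apply: eq_bigr => x _; rewrite big_bool.
Qed.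

Lemma sum_adj (x : T) : \sum_(y : S) (e x (val y))%:R <= D%:R :> R.
Proof.
rewrite -natr_sum ler_nat -big_mkcond sum1_card cardE -(size_map val).
apply: (@deg_le x); first by rewrite map_inj_uniq ?enum_uniq//; exact: val_inj.
by apply/allP => y /mapP[z]; rewrite mem_enum => xz ->.
Qed.

(** In each row only the entries with the opposite boolean survive, so the pairs cost nothing over
    the rows of [Hmat]. *)
Lemma sum_Kmat_abs (P : pred J) i :
  \sum_(j | P j) `|Kmat i j| <= \sum_(y : S | P (y, ~~ i.2)) `|Hmat (val i.1) (val y)|.
Proof.
rewrite big_mkcond sum_pairb [leRHS]big_mkcond/=; apply: ler_sum => y _.
case: i => x [|]; rewrite /Kmat/= ?normr0 ?if_same ?add0r ?addr0;
  by case: ifP => // _; rewrite normrM ?expr1 ?normrN ?normr1 mul1r.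
Qed.

Lemma Kmat_bnd i : \sum_j `|Kmat i j| <= D%:R + C.
Proof.
rewrite (le_trans (sum_Kmat_abs _ _))//.
apply: (@le_trans _ _ (\sum_(y : S) ((e (val i.1) (val y))%:R + (y == i.1)%:R * C))).
  apply: ler_sum => y _; rewrite (le_trans (ler_normD _ _))// normr_nat lerD2l.
  by rewrite normrM normr_nat ler_pM// eq_sym.
rewrite big_split/= lerD ?sum_adj// (bigD1 i.1)//= eqxx mul1r big1 ?addr0// => y /negbTE ->.
by rewrite mul0r.
Qed.

Let d (j : J) := gdist e o (val j.1).

(** Indices at different distances sit at different vertices, so the potential drops out and only
    edges are counted. *)
Lemma Kmat_off i : \sum_(j | d j != d i) `|Kmat i j| <= D%:R.
Proof.
rewrite (le_trans (sum_Kmat_abs _ _))//.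
apply: le_trans (sum_adj (val i.1)); rewrite [leRHS](bigID (fun y => d (y, ~~ i.2) != d i))/=.
apply: ler_wpDr; first by apply: sumr_ge0.
apply: ler_sum => y dy; rewrite /Hmat; have -> : (val i.1 == val y) = false.
  by apply/negbTE; apply: contra dy => /eqP iy; rewrite /d /= iy.
by rewrite mul0r addr0 normr_nat.
Qed.

Lemma Kmat_loc i j : Kmat i j != 0 -> (d i <= (d j).+1)%N.
Proof.
rewrite /Kmat; case: ifP => [|_]; first by rewrite eqxx.
rewrite mulf_eq0 negb_or => /andP[_]; rewrite /Hmat.
have [ij|_] := eqVneq (val i.1) (val j.1); first by rewrite /d ij leqnSn.
by rewrite mul0r addr0; case exy : (e _ _); rewrite ?eqxx// => _; apply: gdist_adj; rewrite // e_sym.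
Qed.

Definition compo (b : bool) (z : R[i]) : R := if b then complex.Im z else complex.Re z.

(** The compression is exact at a vertex whose neighbours all lie in [S]. Agreement of [u] with
    [phi] is asked only at [x] and its neighbours, because Euler steps lose agreement near the
    boundary of [S]. *)
Lemma Kmat_Hop (u : J -> R) (phi : T -> R[i]) (x : S) b :
  (forall y : S, e (val x) (val y) || (y == x) -> forall b, u (y, b) = compo b (phi (val y))) ->
  (forall y, e (val x) y -> y \in S) ->
  kmul Kmat u (x, b) = compo b (- 'i%R * Hop e V phi (val x)).
Proof.
move=> uE xS.
have -> : compo b (- 'i%R * Hop e V phi (val x)) = (-1) ^+ b * compo (~~ b) (Hop e V phi (val x)).
  by case: b => /=; rewrite ?ReNiM ?ImNiM ?expr1 ?mulN1r ?mul1r.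
have -> : compo (~~ b) (Hop e V phi (val x)) =
   \sum_(y : S) Hmat (val x) (val y) * compo (~~ b) (phi (val y)).
  have -> : compo (~~ b) (Hop e V phi (val x)) =
     \sum_(y <- nbrs (val x)) compo (~~ b) (phi y) + V (val x) * compo (~~ b) (phi (val x)).
    by rewrite (HopE V deg_le); case: b => /=; rewrite -?Re_sum -?Im_sum -?Re_realM -?Im_realM; case: (\sum_(_ <- _) _); case: (_ * _).
  rewrite /Hmat; under [RHS]eq_bigr do rewrite mulrDl.
  rewrite big_split/=; congr (_ + _).
    rewrite -(big_seq_fsetE _ _ xpredT (fun y => (e (val x) y)%:R * compo (~~ b) (phi y)))/=.
    rewrite [RHS](bigID (e (val x)))/= [X in _ = _ + X]big1 ?addr0; last by move=> y /negbTE ->; rewrite mul0r.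
    rewrite [RHS](eq_bigr (fun y => compo (~~ b) (phi y))); last by move=> y ->; rewrite mul1r.
    rewrite -[RHS]big_filter; apply: perm_big; apply: uniq_perm; rewrite ?filter_uniq ?fset_uniq//.
    move=> y; rewrite mem_filter (in_nbrs deg_le); case exy : (e _ _) => //=.
    by rewrite xS.
  rewrite (bigD1 x)//= eqxx mul1r [X in _ + X]big1 ?addr0// => y yx.
  by rewrite (_ : (val x == val y) = false) ?mul0r// (inj_eq val_inj) eq_sym; apply/negbTE.
rewrite /kmul sum_pairb mulr_sumr; apply: eq_bigr => y _; rewrite /Kmat /=.
have [exy|exy] := boolP (e (val x) (val y) || (y == x)).
  by case: b; rewrite !uE//= mul0r ?addr0 ?add0r mulrA.
have -> : Hmat (val x) (val y) = 0.
  move: exy; rewrite negb_or eq_sym => /andP[/negbTE exy /negbTE yx].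
  by rewrite /Hmat exy (inj_eq val_inj) yx mul0r addr0.
by case: b => /=; rewrite !(mul0r, mulr0) addr0.
Qed.

End Fin.

Lemma compoD b (z w : R[i]) : compo b (z + w) = compo b z + compo b w.
Proof. by case: b; case: z; case: w. Qed.

Lemma compo_realM b (a : R) (z : R[i]) : compo b (a%:C * z) = a * compo b z.
Proof. by case: b; rewrite /= ?Re_realM ?Im_realM. Qed.

Lemma cabs2E (z : R[i]) : cabs2 z = compo true z ^+ 2 + compo false z ^+ 2.
Proof. by rewrite addrC. Qed.

(** Finite propagation: every step consumes one layer of neighbours, so [k] steps remain exact on
    the growth of [F] by [N - k] layers. *)
Lemma euler_step_Hop (F : seq T) (N k : nat) (h : R) (psi : T -> R[i])
    (S : {fset T}) (x : S) b :
  S =i iter N grow F -> (k <= N)%N -> val x \in iter (N - k) grow F ->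
  iter k (euler_step (@Kmat S) h) (fun j => compo j.2 (psi (val j.1))) (x, b) =
  compo b (iter k (Hop_euler e V (- 'i%R * h%:C)) psi (val x)).
Proof.
move=> SE; elim: k x b => [|k IHk] x b kN xF //.
have Nk : (N - k = (N - k.+1).+1)%N by rewrite -subSn.
have kN' := ltnW kN; have near_x y : e (val x) y -> y \in iter (N - k) grow F.
  by move=> exy; rewrite Nk /=; exact: grow_nbrs exy.
have xF' : val x \in iter (N - k) grow F by rewrite Nk /=; exact: sub_grow.
rewrite !iterS [LHS]/euler_step [in RHS]/Hop_euler compoD IHk//; congr (_ + _).
rewrite (@Kmat_Hop _ _ (iter k (Hop_euler e V (- 'i%R * h%:C)) psi)).
- by rewrite -compo_realM; congr (compo _ _); rewrite mulrA [_ * - 'i%R]mulrC.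
- move=> y /orP[exy|/eqP ->] b'; apply: IHk => //; exact: near_x.
- by move=> y exy; rewrite SE; apply: sub_iter_grow (near_x _ exy); exact: leq_subr.
Qed.

(** The final bound of the theorem, with [a q] standing for the norm of [x^q psi] and the
    coefficient of [a q] for [p_(m-q)(t)]. *)
Definition moment_bound (m : nat) (a : nat -> R) (t : R) : R :=
  \sum_(q < m.+1) 'C(m, q)%:R * (D%:R * t + (m - q)%:R) ^+ (m - q) * a q.

Lemma sum_Hop_euler_le (F : {fset T}) m n (t : R) (psi : T -> R[i]) (a : nat -> R) :
  0 <= t -> (forall q, 0 <= a q) ->
  (forall q (S : {fset T}), (q <= m)%N ->
     \sum_(x <- S) (gdist e o x)%:R ^+ (2 * q) * cabs2 (psi x) <= a q ^+ 2) ->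
  \sum_(x <- F) (gdist e o x)%:R ^+ (2 * m)
      * cabs2 (iter n.+1 (Hop_euler e V (- 'i%R * (t / n.+1%:R)%:C)) psi x)
    <= ((1 + (t * (D%:R + C)) ^+ 2 / n.+1%:R ^+ 2) ^+ n.+1 * moment_bound m a t) ^+ 2.
Proof.
move=> t0 a0 ha; set h := t / n.+1%:R; have h0 : 0 <= h by rewrite divr_ge0.
(* One layer for each of the [n.+1] steps keeps the truncated iterate exact on [F] itself. *)
pose S : {fset T} := [fset x in iter n.+1 grow F]%fset.
have SE : S =i iter n.+1 grow F by move=> x; rewrite in_fset.
have FS : {subset F <= S} by move=> x xF; rewrite SE; apply: (@sub_iter_grow 0).
pose d (j : (S * bool)%type) := gdist e o (val j.1).
pose u := fun j : (S * bool)%type => compo j.2 (psi (val j.1)).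
pose phi := iter n.+1 (Hop_euler e V (- 'i%R * h%:C)) psi.
have B0 : 0 <= D%:R + C by rewrite addr_ge0// (le_trans (normr_ge0 _) (V_bnd o)).
have dist_sqr (x : R) (k : nat) (z : R[i]) : x ^+ (2 * k) * cabs2 z =
    (x ^+ k * compo true z) ^+ 2 + (x ^+ k * compo false z) ^+ 2.
  by rewrite cabs2E mulnC exprM !exprMn mulrDr.
have weight_u q : (q <= m)%N -> fnorm (weight d q u) <= a q.
  move=> qm; apply: fnorm_le => //; apply: le_trans (ha q S qm).
  rewrite big_seq_fsetE/= sum_pairb le_eqVlt; apply/orP; left; apply/eqP.
  by apply: eq_bigr => x _; rewrite dist_sqr.
have Fle : \sum_(x <- F) (gdist e o x)%:R ^+ (2 * m) * cabs2 (phi x)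
    <= fnorm (weight d m (iter n.+1 (euler_step (@Kmat S) h) u)) ^+ 2.
  rewrite fnorm_sqr sum_pairb.
  have -> : \sum_(x <- F) (gdist e o x)%:R ^+ (2 * m) * cabs2 (phi x) =
      \sum_(x : S | val x \in F) (gdist e o (val x))%:R ^+ (2 * m) * cabs2 (phi (val x)).
    rewrite -(big_seq_fsetE _ S (fun x => x \in F) (fun x => (gdist e o x)%:R ^+ (2 * m) * cabs2 (phi x)))/=.
    rewrite -[RHS]big_filter; apply: perm_big; apply: uniq_perm; rewrite ?filter_uniq ?fset_uniq//.
    by move=> x; rewrite mem_filter; case: (boolP (x \in F)) => //= /FS ->.
  rewrite [leRHS](bigID (fun x => val x \in F))/= -[leLHS]addr0; apply: lerD; last first.
    by apply: sumr_ge0 => x _; rewrite addr_ge0 ?sqr_ge0.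
  apply: ler_sum => x xF.
  have ux b : iter n.+1 (euler_step (@Kmat S) h) u (x, b) = compo b (phi (val x)).
    by apply: (euler_step_Hop _ _ _ SE); rewrite // subnn.
  rewrite /weight -!iterS !ux.
  by rewrite dist_sqr.
apply: le_trans Fle _.
have c0 : 0 <= (1 + (h * (D%:R + C)) ^+ 2) ^+ n.+1 by rewrite exprn_ge0// addr_ge0// sqr_ge0.
have cE : 1 + (t * (D%:R + C)) ^+ 2 / n.+1%:R ^+ 2 = 1 + (h * (D%:R + C)) ^+ 2.
  by rewrite /h; congr (_ + _); rewrite !exprMn exprVn; ring.
rewrite cE lerXn2r ?nnegrE ?fnorm_ge0 ?mulr_ge0//.
  by apply: sumr_ge0 => q _; rewrite !mulr_ge0 ?exprn_ge0 ?addr_ge0 ?mulr_ge0.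
apply: le_trans (fnorm_weight_euler (@Kmat_anti S) (@Kmat_bnd S) (@Kmat_off S) (@Kmat_loc S) B0 _ h0 m n.+1 u) _ => //.
rewrite ler_wpM2l//; apply: ler_sum => q _.
have -> : n.+1%:R * h = t by rewrite /h mulrC divfK ?pnatr_eq0.
by rewrite ler_wpM2l ?weight_u -1?ltnS// mulr_ge0 ?exprn_ge0 ?addr_ge0 ?mulr_ge0.
Qed.

Lemma cvg_cabs2_sum (F : seq T) (w : T -> R) (E : nat -> T -> R[i]) (f : T -> R[i]) :
  (forall x, (fun n => complex.Re (E n x)) @ \oo --> complex.Re (f x) /\
             (fun n => complex.Im (E n x)) @ \oo --> complex.Im (f x)) ->
  (fun n => \sum_(x <- F) w x * cabs2 (E n x)) @ \oo --> \sum_(x <- F) w x * cabs2 (f x).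
Proof.
move=> Ef; elim: F => [|x F IHF].
  by under eq_fun do rewrite big_nil; rewrite big_nil; exact: cvg_cst.
under eq_fun do rewrite big_cons; rewrite big_cons; apply: cvgD => //.
apply: cvgM; first exact: cvg_cst.
by have [h1 h2] := Ef x; rewrite /cabs2; apply: cvgD; rewrite expr2; under eq_fun do rewrite expr2; apply: cvgM.
Qed.

(** From [1 + y <= expR y], the factor lies between 1 and [expR (c ^+ 2 / n.+1)]. *)
Lemma cvg_euler_factor (c : R) :
  (fun n => (1 + c ^+ 2 / n.+1%:R ^+ 2) ^+ n.+1) @ \oo --> (1 : R).
Proof.
apply: (@squeeze_cvgr _ _ _ _ (fun=> 1) (fun n => expR (c ^+ 2 * harmonic n))).
- near=> n; have y0 : 0 <= c ^+ 2 / n.+1%:R ^+ 2 by rewrite divr_ge0 ?sqr_ge0.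
  rewrite exprn_ege1 ?lerDl//=.
  have -> : c ^+ 2 * harmonic n = n.+1%:R * (c ^+ 2 / n.+1%:R ^+ 2).
    have : n.+1%:R != 0 :> R by rewrite pnatr_eq0.
    by rewrite /harmonic/=; set N := n.+1%:R => N0; field.
  by rewrite expRM_natl lerXn2r ?nnegrE ?expR_ge0 ?addr_ge0 ?expR_ge1Dx.
- exact: cvg_cst.
- rewrite -expR0; apply: continuous_cvg; first exact: continuous_expR.
  rewrite -[X in _ --> X](mulr0 (c ^+ 2)); apply: cvgM; [exact: cvg_cst|exact: cvg_harmonic].
Unshelve. all: by end_near. Qed.

(** The truncation set grows with [n], but the bound on the fixed finite sum over [F] does not
    depend on it, so pointwise convergence suffices. *)
Lemma sum_evol_le (F : {fset T}) m (t : R) (psi : T -> R[i]) (a : nat -> R) :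
  0 <= t -> (forall q, 0 <= a q) ->
  (forall q (S : {fset T}), (q <= m)%N ->
     \sum_(x <- S) (gdist e o x)%:R ^+ (2 * q) * cabs2 (psi x) <= a q ^+ 2) ->
  (exists M, forall x, cbnd M (psi x)) ->
  \sum_(x <- F) (gdist e o x)%:R ^+ (2 * m) * cabs2 (evol e V t psi x)
    <= moment_bound m a t ^+ 2.
Proof.
move=> t0 a0 ha [M psiM].
have c1 := @cvg_cabs2_sum F (fun x => (gdist e o x)%:R ^+ (2 * m))
  (fun n x => iter n.+1 (Hop_euler e V (- 'i%R * (t / n.+1%:R)%:C)) psi x) _
  (fun x => evol_cvg deg_le V_bnd x t0 psiM).
have c2 : (fun n => ((1 + (t * (D%:R + C)) ^+ 2 / n.+1%:R ^+ 2) ^+ n.+1 * moment_bound m a t) ^+ 2) @ \oo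
    --> moment_bound m a t ^+ 2.
  have c3 : (fun n => (1 + (t * (D%:R + C)) ^+ 2 / n.+1%:R ^+ 2) ^+ n.+1 * moment_bound m a t) @ \oo --> moment_bound m a t.
    by rewrite -[X in _ --> X]mul1r; apply: cvgM; [exact: cvg_euler_factor|exact: cvg_cst].
  by under eq_fun do rewrite expr2; rewrite expr2; apply: cvgM.
apply: ler_cvg_to c1 c2 _; near=> n; exact: sum_Hop_euler_le.
Unshelve. all: by end_near. Qed.

End Truncation.

(** * Weighted norms and polynomial growth *)

(** Convexity of the power on the segment from [x] to [x + y]. With [u = t^-1] it isolates the
    leading term with an error of order [t^-1]. *)
Lemma expr_convex (R : realFieldType) (x y u : R) m : 0 <= x -> 0 <= y -> 0 <= u <= 1 ->
  (x + u * y) ^+ m <= (1 - u) * x ^+ m + u * (x + y) ^+ m.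
Proof.
move=> x0 y0 /andP[u0 u1]; elim: m => [|m IHm]; first by rewrite !expr0; lra.
have xuy : 0 <= x + u * y by rewrite addr_ge0// mulr_ge0.
rewrite exprS (le_trans (ler_wpM2l xuy IHm))// -subr_ge0 !exprS.
have : x ^+ m <= (x + y) ^+ m by rewrite lerXn2r ?nnegrE ?addr_ge0// lerDl.
set X := x ^+ m; set Y := (x + y) ^+ m => XY.
rewrite (_ : _ - _ = (1 - u) * u * y * (Y - X)); last by ring.
by rewrite !mulr_ge0// subr_ge0.
Qed.

(** * Large-time growth of the moment bound *)

Section Moments.
Variables (R : realType) (D : nat).

Lemma moment_bound_ge0 m (a : nat -> R) (t : R) :
  0 <= t -> (forall q, 0 <= a q) -> 0 <= moment_bound D m a t.
Proof.
by move=> t0 a0; apply: sumr_ge0 => q _; rewrite !mulr_ge0 ?exprn_ge0 ?addr_ge0 ?mulr_ge0.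
Qed.

(** Only [q = 0] reaches order [t ^+ m], and convexity splits it into the leading term and a
    remainder. The other terms have degree at most [m - 1] in [t], so dividing by [t ^+ m] leaves a
    factor [t^-1]. *)
Lemma moment_bound_growth m (a : nat -> R) (t : R) : 1 <= t -> (forall q, 0 <= a q) ->
  moment_bound D m a t / t ^+ m <=
  D%:R ^+ m * a 0%N + (\sum_(q < m.+1) 'C(m, q)%:R * (D%:R + m%:R) ^+ (m - q) * a q) / t.
Proof.
move=> t1 a0; have t0 : 0 < t := lt_le_trans ltr01 t1.
have tn0 : t != 0 by rewrite gt_eqF.
have u0 : 0 <= t^-1 by rewrite invr_ge0 ltW.
have u1 : t^-1 <= 1 by rewrite invf_le1.
have Dm k : (k <= m)%N -> D%:R * t + k%:R <= (D%:R + m%:R) * t.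
  move=> km; rewrite mulrDl lerD2l; apply: (@le_trans _ _ m%:R); first by rewrite ler_nat.
  by rewrite ler_peMr.
rewrite /moment_bound !mulr_suml !big_ord_recl/= !bin0 !subn0 !mul1r addrA; apply: lerD.
  have -> : (D%:R * t + m%:R) ^+ m * a 0%N / t ^+ m = (D%:R + t^-1 * m%:R) ^+ m * a 0%N.
    rewrite mulrAC -expr_div_n; congr (_ ^+ _ * _); by field.
  rewrite mulrAC -mulrDl ler_wpM2r// (le_trans (expr_convex _ _ _ (_ : 0 <= t^-1 <= 1)))// ?u0//.
  by rewrite [_ / t]mulrC lerD2r ler_piMl ?exprn_ge0// gerBl.
apply: ler_sum => q _; rewrite /bump/= add1n.
rewrite -!mulrA ler_wpM2l// mulrCA [leRHS]mulrCA ler_wpM2l//.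
rewrite ler_pdivrMr ?exprn_gt0//.
have qm : (q < m)%N := ltn_ord q.
apply: (@le_trans _ _ ((D%:R + m%:R) ^+ (m - q.+1) * t ^+ (m - q.+1))).
  rewrite -exprMn lerXn2r ?nnegrE ?addr_ge0 ?mulr_ge0 ?addr_ge0 ?(ltW t0)//.
  by rewrite Dm// leq_subr.
rewrite -!mulrA ler_wpM2l ?exprn_ge0 ?addr_ge0//.
rewrite mulrC ler_pdivlMr// -exprSr.
by apply: ler_weXn2l => //; rewrite -subSn// subSS leq_subr.
Qed.

End Moments.

(** * Weighted norms through finite sums *)

Section WeightedNorm.
Variables (R : realType) (T : countType) (e : rel T) (o : T).
Implicit Types psi : T -> R[i].

Lemma cabs2_ge0 (z : R[i]) : 0 <= cabs2 z.
Proof. by rewrite addr_ge0 ?sqr_ge0. Qed.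

Lemma wnorm2_ge0 q psi : (0 <= wnorm2 e o q psi)%E.
Proof. by apply: esum_ge0 => x _; rewrite lee_fin mulr_ge0 ?exprn_ge0 ?cabs2_ge0. Qed.

Lemma wnorm2_ge_sum q psi (S : {fset T}) :
  ((\sum_(x <- S) (gdist e o x)%:R ^+ (2 * q) * cabs2 (psi x))%:E <= wnorm2 e o q psi)%E.
Proof.
apply: esum_ge; exists [set` S]; first by split.
by rewrite -fsbig_seq ?fset_uniq// sumEFin.
Qed.

Lemma wnorm2_le q psi (c : R) :
  (forall S : {fset T}, \sum_(x <- S) (gdist e o x)%:R ^+ (2 * q) * cabs2 (psi x) <= c) ->
  (wnorm2 e o q psi <= c%:E)%E.
Proof.
move=> Sc; apply: ub_ereal_sup => _ [A [finA _] <-].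
by rewrite fsbig_finite// sumEFin lee_fin.
Qed.

Lemma wnorm_ge0 q psi : 0 <= wnorm e o q psi.
Proof. exact: sqrtr_ge0. Qed.

Lemma sum_le_wnorm_sqr q psi (S : {fset T}) : (wnorm2 e o q psi < +oo)%E ->
  \sum_(x <- S) (gdist e o x)%:R ^+ (2 * q) * cabs2 (psi x) <= wnorm e o q psi ^+ 2.
Proof.
move=> fin_q; rewrite sqr_sqrtr ?fine_ge0 ?wnorm2_ge0//.
by rewrite -lee_fin fineK ?wnorm2_ge_sum// ge0_fin_numE ?wnorm2_ge0.
Qed.

(** Pointwise, the weight of order [q] is at most the sum of those of orders 0 and [m]. This gives
    meaning to the intermediate norms, as finiteness is assumed only at the two ends. *)
Lemma wnorm2_interp q m psi : (q <= m)%N -> (wnorm2 e o 0 psi < +oo)%E ->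
  (wnorm2 e o m psi < +oo)%E -> (wnorm2 e o q psi < +oo)%E.
Proof.
move=> qm fin0 finm; apply: (@le_lt_trans _ _ (wnorm2 e o 0 psi + wnorm2 e o m psi)%E); last first.
  exact: lte_add_pinfty.
rewrite /wnorm2 -esumD; last 2 first.
- by move=> x _; rewrite lee_fin mulr_ge0 ?exprn_ge0 ?cabs2_ge0.
- by move=> x _; rewrite lee_fin mulr_ge0 ?exprn_ge0 ?cabs2_ge0.
apply: le_esum => x _; rewrite -EFinD lee_fin -mulrDl ler_wpM2r ?cabs2_ge0// muln0 expr0.
rewrite -!natrX nat1r ler_nat; case: (gdist e o x) => [|k].
  (* At distance 0 the weight of order 0 is [0 ^ 0 = 1], covered by the summand 1. *)
  by case: (2 * q)%N => [|n]//; rewrite exp0n.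
by rewrite (leq_trans (leq_pexp2l _ (_ : 2 * q <= 2 * m)%N)) ?leqnSn// leq_mul2l.
Qed.

Lemma cbnd_wnorm psi x : (wnorm2 e o 0 psi < +oo)%E -> cbnd (wnorm e o 0 psi) (psi x).
Proof.
move=> fin0; have := sum_le_wnorm_sqr [fset x]%fset fin0.
rewrite big_seq_fset1 muln0 expr0 mul1r => le_x.
by split; rewrite -(@ler_pXn2r _ 2)// ?nnegrE ?wnorm_ge0// real_normK ?num_real//;
  apply: le_trans le_x; rewrite /cabs2 ?lerDl ?lerDr sqr_ge0.
Qed.

End WeightedNorm.

Theorem theoremA1 (R : realType) (T : countType) (e : rel T) (D : nat)
  (V : T -> R) (o : T) (m : nat)
  (e_sym : symmetric e) (e_irr : irreflexive e)
  (e_conn : forall x : T, exists n : nat, walk_len e o x n)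
  (D_pos : (0 < D)%N)
  (deg_le : forall (x : T) (s : seq T), uniq s -> all (e x) s -> (size s <= D)%N)
  (V_bnd : exists C : R, forall x : T, `|V x| <= C) :
  exists p : nat -> {poly R},
    [/\ (forall k : nat, (k <= m)%N -> size (p k) = k.+1),
        p 0%N = 1,
        lead_coef (p m) = (D%:R) ^+ m &
        forall psi : T -> R[i],
          (wnorm2 e o 0 psi < +oo)%E -> (wnorm2 e o m psi < +oo)%E ->
          (forall t : R, 0 <= t ->
             (wnorm2 e o m (evol e V t psi) < +oo)%E /\
             wnorm e o m (evol e V t psi)
               <= \sum_(r < m.+1) (p (m - r)%N).[t] * wnorm e o r psi)
          /\
          (forall eps : R, 0 < eps -> exists T0 : R, forall t : R, T0 <= t -> 0 < t ->
             wnorm e o m (evol e V t psi) / t ^+ m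
               <= (D%:R) ^+ m * wnorm e o 0 psi + eps)].
Proof.
have [C VC] := V_bnd.
pose l k : {poly R} := D%:R *: 'X + k%:R%:P.
have D0 : D%:R != 0 :> R by rewrite pnatr_eq0 -lt0n.
have sDX k : (size (k%:R%:P : {poly R}) < size (D%:R *: 'X : {poly R}))%N.
  by rewrite size_scale// size_polyX ltnS size_polyC_leq1.
have sl k : size (l k) = 2%N by rewrite size_polyDl// size_scale// size_polyX.
have ll k : lead_coef (l k) = D%:R by rewrite lead_coefDl// lead_coefZ lead_coefX mulr1.
(* These are the coefficients of [moment_bound] as polynomials in [t]; since [D] is nonzero, the
   degree is exactly [k] for [k <= m]. *)
exists (fun k => 'C(m, k)%:R *: l k ^+ k); split.
- move=> k km; rewrite size_scale ?pnatr_eq0 -?lt0n ?bin_gt0//.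
  have l0 : l k != 0 by rewrite -size_poly_gt0 sl.
  by rewrite -[LHS]prednK ?size_poly_gt0 ?expf_neq0// size_exp sl mul1n.
- by rewrite bin0 scale1r.
- by rewrite binn scale1r lead_coef_exp ll.
move=> psi fin0 finm.
pose a q := wnorm e o q psi.
have a0 q : 0 <= a q by exact: wnorm_ge0.
have a_sum q (S : {fset T}) : (q <= m)%N ->
    \sum_(x <- S) (gdist e o x)%:R ^+ (2 * q) * cabs2 (psi x) <= a q ^+ 2.
  by move=> qm; exact: (sum_le_wnorm_sqr _ (wnorm2_interp qm fin0 finm)).
have psi_bnd : exists M, forall x, cbnd M (psi x).
  by exists (wnorm e o 0 psi) => x; exact: (cbnd_wnorm _ fin0).
have evol_le t : 0 <= t -> (wnorm2 e o m (evol e V t psi) <= (moment_bound D m a t ^+ 2)%:E)%E.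
  move=> t0; apply: wnorm2_le => S.
  exact: (sum_evol_le e_sym e_conn deg_le VC S t0 a0 a_sum psi_bnd).
have wnorm_le t : 0 <= t -> wnorm e o m (evol e V t psi) <= moment_bound D m a t.
  move=> t0; have P0 := moment_bound_ge0 D m t0 a0.
  (* Removing [fine] requires a finite value, which [evol_le] provides. *)
  rewrite -[leRHS]ger0_norm// -sqrtr_sqr; apply: ler_wsqrtr; rewrite -lee_fin fineK ?evol_le//.
  by rewrite ge0_fin_numE ?wnorm2_ge0// (le_lt_trans (evol_le t t0))// ltry.
split=> [t t0|eps eps0].
  split; first by rewrite (le_lt_trans (evol_le t t0))// ltry.
  apply: le_trans (wnorm_le t t0) _; rewrite le_eqVlt; apply/orP; left; apply/eqP.
  apply: eq_bigr => r _; congr (_ * _); by rewrite !hornerE bin_sub// -ltnS.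
set K := \sum_(q < m.+1) 'C(m, q)%:R * (D%:R + m%:R) ^+ (m - q) * a q.
have K0 : 0 <= K by apply: sumr_ge0 => q _; rewrite !mulr_ge0 ?exprn_ge0 ?addr_ge0.
(* The summand 1 ensures [1 <= t], and [K / eps] ensures [K / t <= eps]. *)
exists (1 + K / eps) => t Tt t0.
have t1 : 1 <= t by rewrite (le_trans _ Tt)// lerDl divr_ge0// ltW.
have tm : 0 <= (t ^+ m)^-1 by rewrite invr_ge0 exprn_ge0// ltW.
apply: le_trans (ler_wpM2r tm (wnorm_le t (ltW t0))) _.
apply: le_trans (moment_bound_growth D m t1 a0) _; rewrite lerD2l -/K.
rewrite ler_pdivrMr// mulrC -ler_pdivrMr//; apply: le_trans Tt.
by rewrite lerDr.
Qed.
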